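(* Let $f$ be an injective piecewise affine map (PAM) with two intervals. Suppose there exist an $f$-invariant density function $\phi$ and constants $K_{min}>0$ and $K_{max}<+\infty$ such that $K_{min}<\phi(x)<K_{max}$ for all $x$ in the domain of $f$. Then the (point-to-point) reachability problem for $f$ is decidable.
   Context: $S^1=\mathbb{Q}/\mathbb{Z}$ denotes the rational unit circle, identified with the set of rational numbers in $[0,1)$. A map $f:S^1\to S^1$ is a one-dimensional piecewise affine map (PAM) with $l$ intervals if $S^1=X_1\cup\dots\cup X_l$ for a finite family of disjoint intervals $X_1,\dots,X_l$ with rational endpoints, and $f(x)=a_ix+b_i$ for $x\in X_i$, where $a_i,b_i\in\mathbb{Q}$. Its derivative is defined by $f'(x)=a_i$ for $x\in X_i$. The orbit of $x$ is $O_f(x)=\{f^i(x)\mid i\in\{0,1,2,\ldots\}\}$. The (point-to-point) reachability problem for $f$ is: given rational points $x,y\in S^1$, decide whether $y\in O_f(x)$. Density functions: an ensemble $A$ is a sequence of points; for a set $I$ let $F^A_I(n)=|\{i\in\{0,1,2,\ldots\}\mid i\le n,\ A(i)\in I\}|$. The distribution function of $A$ is $\Phi_A(x)=\lim_{n\to\infty}F^A_{(-\infty,x)}(n)/n$ (if the limits exist), and its density function is $\phi_A=\Phi_A'$. The transfer (Perron–Frobenius) operator of $f$ is $L_f(\phi)(x)=\sum_{y\in f^{-1}(x)}\frac{\phi(y)}{|f'(y)|}$. A density function $\phi$ is $f$-invariant if $L_f(\phi)=\phi$, i.e. $\phi(x)=\sum_{y\in f^{-1}(x)}\frac{\phi(y)}{|f'(y)|}$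 for all $x$. *)

(* Defs.v *)
From HB Require Import structures.
From mathcomp Require Import all_boot all_order all_algebra.
From mathcomp Require Import all_classical all_reals all_analysis.
Set Implicit Arguments.
Unset Strict Implicit.
Unset Printing Implicit Defensive.
Import Order.TTheory GRing.Theory Num.Theory.
Import numFieldNormedType.Exports.
Local Open Scope classical_set_scope.
Local Open Scope ring_scope.

(* The rational circle Q/Z, each class represented by its element of [0,1[. *)
Definition S1 := {x : rat | 0 <= x < 1}.

(* A piecewise affine map with l intervals.  The equation in pam_mapE is an
   equality in Q/Z, hence modulo the integers; it holds in particular when
   slope i * x + offset i already lies in [0,1[ and is the value of the map.
   An interval of any kind (open, closed, half-open, a single point) is
   allowed; its end points are rational because it is nonempty and bounded in
   the type [interval rat]. *)
Record PAM (l : nat) := MkPAM {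
  pam_itv : 'I_l -> interval rat;
  slope : 'I_l -> rat;
  offset : 'I_l -> rat;
  pam_map :> S1 -> S1;
  pam_itv_neq0 : forall i, exists x : rat, x \in pam_itv i;
  pam_itv_sub : forall i (x : rat), x \in pam_itv i -> 0 <= x < 1;
  pam_itv_cover : forall x : S1, exists i, \val x \in pam_itv i;
  pam_itv_disj : forall i j (x : rat),
    x \in pam_itv i -> x \in pam_itv j -> i = j;
  pam_mapE : forall i (x : S1), \val x \in pam_itv i ->
    slope i * \val x + offset i - \val (pam_map x) \is a Num.int
}.

(* Exactly one interval contains x, so the sum has exactly one term. *)
Definition pam_deriv (l : nat) (f : PAM l) (x : S1) : rat :=
  \sum_(i < l | \val x \in pam_itv f i) slope f i.

Definition orbit_of (f : S1 -> S1) (x : S1) : set S1 :=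
  [set iter i f x | i in [set: nat]].

Definition hits (A : nat -> S1) (I : interval rat) (n : nat) : nat :=
  #|[set i : 'I_n.+1 | \val (A i) \in I]|.

Definition is_distribution (R : realType) (A : nat -> S1) (Phi : rat -> R) :=
  forall x : rat,
    (hits A `]-oo, x[ n)%:R / n%:R @[n --> \oo] --> Phi x.

(* Phi' is taken inside the domain [0,1[ of the ensemble: it is a two-sided
   derivative at x > 0 and a right derivative at 0 (Phi vanishes on ]-oo, 0]).
   The type rat^o is rat with its usual topology. *)
Definition is_derivative_on_S1 (R : realType) (Phi : rat -> R) (phi : S1 -> R) :=
  forall x : S1,
    (Phi t - Phi (\val x)) / ratr (t - \val x)
      @[t --> within [set t : rat^o | 0 <= t < 1] ((\val x : rat^o)^')]
      --> phi x.

Definition is_density (R : realType) (phi : S1 -> R) :=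
  exists (A : nat -> S1) (Phi : rat -> R),
    is_distribution A Phi /\ is_derivative_on_S1 Phi phi.

(* The sum over the fibre is the library's finitely supported sum; the fibres
   are finite as soon as no slope is 0.  Division by 0 gives 0, so if f is
   injective and has slope 0 at y then transfer f phi (f y) = 0, which excludes
   invariant phi > 0. *)
Definition transfer (R : realType) (l : nat) (f : PAM l) (phi : S1 -> R) :
    S1 -> R :=
  fun x => \sum_(y \in f @^-1` [set x]) (phi y / `|ratr (pam_deriv f y)|).

Definition invariant_density (R : realType) (l : nat) (f : PAM l)
    (phi : S1 -> R) :=
  is_density phi /\ transfer f phi = phi.

(* Kleene's partial recursive functions of n natural arguments. *)
Inductive recfun : nat -> Type :=
| RZero n : recfun n
| RSucc : recfun 1
| RProj n (i : 'I_n) : recfun n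
| RComp m n (g : recfun m) (h : 'I_m -> recfun n) : recfun n
| RPrec n (g : recfun n) (h : recfun n.+2) : recfun n.+1
| RMin n (g : recfun n.+1) : recfun n.

(* computes e v y: the computation of e on v terminates with value y.  For
   RPrec g h, the value at 0, v is g v and the value at k.+1, v is h applied
   to k, the value at k, v and v.  RMin g looks for the least z with
   g (z, v) = 0, all earlier values being defined. *)
Fixpoint computes (n : nat) (e : recfun n) : n.-tuple nat -> nat -> Prop :=
  match e in recfun n return n.-tuple nat -> nat -> Prop with
  | RZero _ => fun _ y => y = 0%N
  | RSucc => fun v y => y = (thead v).+1
  | RProj _ i => fun v y => y = tnth v i
  | RComp m _ g h => fun v y => exists w : m.-tuple nat,
      (forall i, computes (h i) v (tnth w i)) /\ computes g w y
  | RPrec n g h => fun v y =>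
      let t : n.-tuple nat := [tuple of behead v] in
      (fix loop (k : nat) : nat -> Prop :=
         match k with
         | 0%N => computes g t
         | k'.+1 => fun u => exists z, loop k' z /\
             computes h [tuple of k' :: z :: t] u
         end) (thead v) y
  | RMin _ g => fun v y =>
      computes g [tuple of y :: v] 0%N /\
      (forall z, (z < y)%N ->
         exists u, computes g [tuple of z :: v] u.+1)
  end.

(* Decidability of the set P of instances in T, coded by n-tuples of naturals:
   some algorithm halts on the code of every instance and answers 1 or 0. *)
Definition algo_decidable (T : Type) (n : nat) (code : T -> n.-tuple nat)
    (P : T -> Prop) :=
  exists e : recfun n, forall x : T,
    (P x -> computes e (code x) 1%N) /\ (~ P x -> computes e (code x) 0%N).

(* Numerators and denominators, in lowest terms, of the two points; they are
   nonnegative, so the absolute value only changes their type. *)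
Definition code_points (p : S1 * S1) : 4.-tuple nat :=
  [tuple `|numq (\val p.1)|%N; `|denq (\val p.1)|%N;
         `|numq (\val p.2)|%N; `|denq (\val p.2)|%N].

Definition reachability_decidable (f : S1 -> S1) :=
  algo_decidable code_points (fun p => orbit_of f p.1 p.2).

(* Main.v *)
(* Invariance gives phi (f x) = phi x / |f' x|, so the bounds on phi bound |P|
   away from 0 and +oo for every product P of slopes along an orbit segment.
   Such a product is a^m b^n, with a and b the two slopes. For a prime p,
   v_p(P) = m v_p(a) + n v_p(b), and since m ln |a| + n ln |b| is bounded,
   v_p(P) is a fixed multiple of m (or of n) up to a bounded error; hence it is
   bounded on one side, uniformly over all segments. If it is bounded below,
   the exponent of p in the denominator of f^i x is bounded in terms of x; if
   it is bounded above, the same holds with respect to a later point of the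
   orbit, by running the segment backwards. Together, all points between x and
   y = f^n x have denominators dividing C * den x * den y, so y is reached in
   fewer than C * den x * den y steps or not at all, which a primitive
   recursive search decides. *)
Require Import Defs.
From mathcomp Require Import all_boot all_order all_algebra.
From mathcomp Require Import all_classical all_reals all_analysis.
From mathcomp Require Import zify ring lra.
Set Implicit Arguments.
Unset Strict Implicit.
Unset Printing Implicit Defensive.
Import Order.TTheory GRing.Theory Num.Theory.

(** * Closure properties of total recursive functions *)

(** Predicates are included: the coercion [nat_of_bool] turns them into functions with values 0 and
    1. *)
Definition recursive n (F : n.-tuple nat -> nat) :=
  exists e : recfun n, forall v, computes e v (F v).

Lemma eq_recursive n (F G : n.-tuple nat -> nat) :
  F =1 G -> recursive F -> recursive G.
Proof. by move=> FG [e eF]; exists e => v; rewrite -FG. Qed.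

Lemma recursive_proj n (i : 'I_n) :
  recursive (fun v : n.-tuple nat => tnth v i).
Proof. by exists (RProj i). Qed.

Lemma recursive_comp m n (G : m.-tuple nat -> nat)
    (T : n.-tuple nat -> m.-tuple nat) :
  recursive G -> (forall i, recursive (fun v => tnth (T v) i)) ->
  recursive (fun v => G (T v)).
Proof.
move=> [g gG] /choice[h hT]; exists (RComp g h) => v.
by exists (T v); split => [i|]; [exact: hT | exact: gG].
Qed.

Lemma recursive_succ n (F : n.-tuple nat -> nat) :
  recursive F -> recursive (fun v => (F v).+1).
Proof.
move=> rF; apply: (@recursive_comp 1 n (fun v => (thead v).+1)
  (fun v => [tuple F v])) => [|i].
  by exists RSucc.
by apply: eq_recursive rF => v; rewrite ord1 (tnth_nth 0).
Qed.

Lemma recursive_const n (c : nat) : recursive (fun _ : n.-tuple nat => c).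
Proof.
elim: c => [|c IHc]; first by exists (RZero n).
exact: recursive_succ IHc.
Qed.

Definition tail2 n (w : n.+2.-tuple nat) : n.-tuple nat :=
  [tuple of behead (behead w)].

Lemma recursive_tail2 n (F : n.-tuple nat -> nat) :
  recursive F -> recursive (fun w => F (tail2 w)).
Proof.
move=> rF; apply: recursive_comp rF _ => i.
apply: eq_recursive (recursive_proj (lift ord0 (lift ord0 i))) => w.
by rewrite !(tnth_nth 0) /= !nth_behead.
Qed.

Lemma recursive_prec n (G : n.-tuple nat -> nat) (H : n.+2.-tuple nat -> nat) :
  recursive G -> recursive H ->
  recursive (fun v : n.+1.-tuple nat =>
    nat_rect (fun=> nat) (G [tuple of behead v])
      (fun k z => H [tuple of k :: z :: [tuple of behead v]]) (thead v)).
Proof.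
move=> [g gG] [h hH]; exists (RPrec g h) => v /=.
elim: (thead v) => [|k IHk] /=; first exact: gG.
by eexists; split; [exact: IHk | exact: hH].
Qed.

(** The working form of primitive recursion: the number of rounds is itself computed from the
    parameters [v], and the step sees the counter, the previous value and all of [v]. *)
Lemma recursive_rect n (B G : n.-tuple nat -> nat)
    (H : nat -> nat -> n.-tuple nat -> nat) :
  recursive B -> recursive G ->
  recursive (fun w : n.+2.-tuple nat =>
    H (tnth w ord0) (tnth w (lift ord0 ord0)) (tail2 w)) ->
  recursive (fun v =>
    nat_rect (fun=> nat) (G v) (fun k z => H k z v) (B v)).
Proof.
move=> rB rG rH; have rP := recursive_prec rG rH.
apply: eq_recursive (@recursive_comp _ n _ (fun v => [tuple of B v :: v]) rP _)
  => [v|i].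
  rewrite theadE; have -> : [tuple of behead [tuple of B v :: v]] = v.
    exact: val_inj.
  elim: (B v) => //= k ->; rewrite !(tnth_nth 0) /=.
  by congr H; exact: val_inj.
case: (unliftP ord0 i) => [j ->|->].
  by apply: eq_recursive (recursive_proj j) => v; rewrite !(tnth_nth 0).
by apply: eq_recursive rB => v; rewrite (tnth_nth 0).
Qed.

Lemma recursive_add n (F G : n.-tuple nat -> nat) :
  recursive F -> recursive G -> recursive (fun v => F v + G v).
Proof.
move=> rF rG; apply: eq_recursive (recursive_rect rG rF
  (H := fun _ z _ => z.+1) _) => [v|].
  by elim: (G v) => [|k /= ->]; rewrite ?addn0 ?addnS.
exact/recursive_succ/recursive_proj.
Qed.

Lemma recursive_mul n (F G : n.-tuple nat -> nat) :
  recursive F -> recursive G -> recursive (fun v => F v * G v).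
Proof.
move=> rF rG; apply: eq_recursive (recursive_rect rG (recursive_const n 0)
  (H := fun _ z v => z + F v) _) => [v|].
  by elim: (G v) => [|k /= ->]; rewrite ?muln0 // mulnS addnC.
by apply: recursive_add; [exact: recursive_proj | exact: recursive_tail2].
Qed.

Lemma recursive_exp n (F G : n.-tuple nat -> nat) :
  recursive F -> recursive G -> recursive (fun v => F v ^ G v).
Proof.
move=> rF rG; apply: eq_recursive (recursive_rect rG (recursive_const n 1)
  (H := fun _ z v => z * F v) _) => [v|].
  by elim: (G v) => [|k /= ->] //; rewrite expnSr.
by apply: recursive_mul; [exact: recursive_proj | exact: recursive_tail2].
Qed.

Lemma recursive_pred n (F : n.-tuple nat -> nat) :
  recursive F -> recursive (fun v => (F v).-1).
Proof.
move=> rF; apply: eq_recursive (recursive_rect rF (recursive_const n 0)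
  (H := fun k _ _ => k) (recursive_proj _)) => v.
by case: (F v).
Qed.

Lemma recursive_sub n (F G : n.-tuple nat -> nat) :
  recursive F -> recursive G -> recursive (fun v => F v - G v).
Proof.
move=> rF rG; apply: eq_recursive (recursive_rect rG rF
  (H := fun _ z _ => z.-1) _) => [v|].
  by elim: (G v) => [|k /= ->]; rewrite ?subn0 ?subnS.
exact/recursive_pred/recursive_proj.
Qed.

(** A recursion of [P v] rounds, that is 0 or 1, starts at [G v] and moves to [F v] in its only
    possible round. *)
Lemma recursive_if n (P : n.-tuple nat -> bool) (F G : n.-tuple nat -> nat) :
  recursive P -> recursive F -> recursive G ->
  recursive (fun v => if P v then F v else G v).
Proof.
move=> rP rF rG; apply: eq_recursive (recursive_rect rP rG
  (H := fun _ _ v => F v) (recursive_tail2 rF)) => v.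
by case: (P v).
Qed.

Lemma recursive_not n (P : n.-tuple nat -> bool) :
  recursive P -> recursive (fun v => ~~ P v).
Proof.
move=> rP; apply: eq_recursive (recursive_sub (recursive_const n 1) rP) => v.
by case: (P v).
Qed.

Lemma recursive_and n (P Q : n.-tuple nat -> bool) :
  recursive P -> recursive Q -> recursive (fun v => P v && Q v).
Proof.
move=> rP rQ; apply: eq_recursive (recursive_mul rP rQ) => v.
by rewrite mulnb.
Qed.

Lemma recursive_leq n (F G : n.-tuple nat -> nat) :
  recursive F -> recursive G -> recursive (fun v => F v <= G v).
Proof.
move=> rF rG; apply: eq_recursive (recursive_sub (recursive_const n 1)
  (recursive_sub rF rG)) => v.
by rewrite /leq; case: (F v - G v).
Qed.

Lemma recursive_eq n (F G : n.-tuple nat -> nat) :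
  recursive F -> recursive G -> recursive (fun v => F v == G v).
Proof.
move=> rF rG; apply: eq_recursive (recursive_and (recursive_leq rF rG)
  (recursive_leq rG rF)) => v.
by rewrite eqn_leq.
Qed.

(** Count up to the dividend and reset to 0 on reaching the modulus. A zero modulus never triggers
    the reset, in accordance with the convention that x modulo 0 is x. *)
Lemma recursive_modn n (F G : n.-tuple nat -> nat) :
  recursive F -> recursive G -> recursive (fun v => F v %% G v).
Proof.
move=> rF rG; apply: eq_recursive (recursive_rect rF (recursive_const n 0)
  (H := fun _ z v => if z.+1 == G v then 0 else z.+1) _) => [v|].
  elim: (F v) => [|k /= ->]; first by rewrite mod0n.
  rewrite [in RHS]modnS; case: (posnP (G v)) => [->|G0].
    by rewrite modn0 dvd0n.
  have := ltn_pmod k G0; rewrite -[X in _ = if G v %| X then _ else _]addn1.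
  rewrite /dvdn -modnDml addn1; case: eqVneq => [->|ne lt].
    by rewrite modnn.
  by have /modn_small-> : (k %% G v).+1 < G v by rewrite ltn_neqAle ne.
have rz := recursive_succ (recursive_proj (lift ord0 ord0 : 'I_n.+2)).
apply: (recursive_if _ _ rz); last exact: recursive_const.
exact: recursive_eq rz (recursive_tail2 rG).
Qed.

Lemma recursive_sum n l (F : 'I_l -> n.-tuple nat -> nat) :
  (forall i, recursive (F i)) -> recursive (fun v => \sum_(i < l) F i v).
Proof.
elim: l F => [|l IHl] F rF.
  apply: eq_recursive (recursive_const n 0) => v; by rewrite big_ord0.
apply: eq_recursive (recursive_add (rF ord0)
  (IHl (fun i => F (lift ord0 i)) _)) => // v.
by rewrite big_ord_recl.
Qed.

Lemma recursive_has_iota n (B : n.-tuple nat -> nat)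
    (P : nat -> n.-tuple nat -> bool) :
  recursive B ->
  recursive (fun w : n.+2.-tuple nat => P (tnth w ord0) (tail2 w)) ->
  recursive (fun v => has (P^~ v) (iota 0 (B v))).
Proof.
move=> rB rP; apply: eq_recursive (recursive_rect rB (recursive_const n 0)
  (H := fun k z v => if P k v then 1 else z) _) => [v|].
  elim: (B v) => // k IHk; rewrite -[k.+1]addn1 iotaD has_cat /= addn1 /= IHk.
  by case: (P k v); rewrite ?orbT ?orbF.
by apply: recursive_if rP _ _; [exact: recursive_const | exact: recursive_proj].
Qed.

(** * Recursive tests on integers and fractions *)

Local Open Scope ring_scope.

Lemma int_subnat (A : int) : exists a b : nat, A = a%:Z - b%:Z.
Proof.
case: A => n; [exists n, 0%N | exists 0%N, n.+1].
  by rewrite subr0.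
by rewrite sub0r NegzE.
Qed.

(** Writing each coefficient as a difference of naturals and moving the negative parts across leaves
    an inequality between naturals. *)
Lemma recursive_lin_ge0 n (A B : int) (P Q : n.-tuple nat -> nat) :
  recursive P -> recursive Q ->
  recursive (fun v => 0 <= A * (P v)%:Z + B * (Q v)%:Z)%R.
Proof.
move=> rP rQ.
have [a [a' ->]] := int_subnat A; have [b [b' ->]] := int_subnat B.
apply: eq_recursive (@recursive_leq _ (fun v => a' * P v + b' * Q v)%N
  (fun v => a * P v + b * Q v)%N _ _) => [v||].
- by congr nat_of_bool; apply/idP/idP; nia.
- by apply: recursive_add; apply: recursive_mul => //; exact: recursive_const.
- by apply: recursive_add; apply: recursive_mul => //; exact: recursive_const.
Qed.

(** The combination is a difference X - Y of naturals, congruent to X + Y (M - 1) modulo M. For M =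
    0 the residue is X - Y itself, and its absolute value is the sum of the two truncated
    differences. *)
Lemma recursive_lin_modz n (A B : int) (P Q M : n.-tuple nat -> nat) :
  recursive P -> recursive Q -> recursive M ->
  recursive (fun v => absz ((A * (P v)%:Z + B * (Q v)%:Z) %% (M v)%:Z)%Z).
Proof.
move=> rP rQ rM.
have [a [a' ->]] := int_subnat A; have [b [b' ->]] := int_subnat B.
pose X v := (a * P v + b * Q v)%N; pose Y v := (a' * P v + b' * Q v)%N.
have rX : recursive X.
  by apply: recursive_add; apply: recursive_mul => //; exact: recursive_const.
have rY : recursive Y.
  by apply: recursive_add; apply: recursive_mul => //; exact: recursive_const.
apply: eq_recursive (@recursive_if _ (fun v => M v == 0%N)
  (fun v => (X v - Y v) + (Y v - X v))%N
  (fun v => (X v + Y v * (M v).-1) %% M v)%N _ _ _) => [v|||].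
- have -> : (a%:Z - a'%:Z) * (P v)%:Z + (b%:Z - b'%:Z) * (Q v)%:Z
      = (X v)%:Z - (Y v)%:Z by rewrite /X /Y; lia.
  case: eqP => [->|/eqP M0]; first by rewrite modz0; lia.
  rewrite -[LHS]/(absz (Posz _)) -modz_nat; congr (absz _).
  rewrite -[RHS](modzMDl (Y v)%:Z); congr modz.
  by case: (M v) M0 => // m _; rewrite PoszD PoszM /= intS; ring.
- by apply: recursive_eq => //; exact: recursive_const.
- by apply: recursive_add; exact: recursive_sub.
- apply: recursive_modn => //; apply: recursive_add => //.
  by apply: recursive_mul => //; exact: recursive_pred.
Qed.

(** Cross-multiplication by the denominators; when [Q v] is 0 the fraction is 0 by convention and
    the answer is a constant. *)
Lemma recursive_le_frac n (c : rat) (P Q : n.-tuple nat -> nat) :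
  recursive P -> recursive Q -> recursive (fun v => c <= (P v)%:R / (Q v)%:R).
Proof.
move=> rP rQ; have r0 := recursive_eq rQ (recursive_const n 0).
have rI := recursive_if r0 (recursive_const n (c <= 0)%R)
  (recursive_lin_ge0 (denq c) (- numq c) rP rQ).
apply: eq_recursive rI => v.
case: eqP => [->|/eqP Q0]; first by rewrite invr0 mulr0.
have d0 : 0 < (denq c)%:~R :> rat by rewrite ltr0z denq_gt0.
congr nat_of_bool; rewrite ler_pdivlMr ?ltr0n ?lt0n // -(ler_pM2l d0).
rewrite -(ler_int rat) -[RHS]subr_ge0 !(rmorphD, rmorphM, rmorphN) /= numqE.
by rewrite -!pmulrn; congr (0 <= _); ring.
Qed.

Lemma recursive_ge_frac n (c : rat) (P Q : n.-tuple nat -> nat) :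
  recursive P -> recursive Q -> recursive (fun v => (P v)%:R / (Q v)%:R <= c).
Proof.
move=> rP rQ; have r0 := recursive_eq rQ (recursive_const n 0).
have rI := recursive_if r0 (recursive_const n (0 <= c)%R)
  (recursive_lin_ge0 (- denq c) (numq c) rP rQ).
apply: eq_recursive rI => v.
case: eqP => [->|/eqP Q0]; first by rewrite invr0 mulr0.
have d0 : 0 < (denq c)%:~R :> rat by rewrite ltr0z denq_gt0.
congr nat_of_bool; rewrite ler_pdivrMr ?ltr0n ?lt0n // -(ler_pM2l d0).
rewrite -(ler_int rat) -[RHS]subr_ge0 !(rmorphD, rmorphM, rmorphN) /= numqE.
by rewrite -!pmulrn; congr (0 <= _); ring.
Qed.

Lemma recursive_itv n (I : interval rat) (P Q : n.-tuple nat -> nat) :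
  recursive P -> recursive Q ->
  recursive (fun v => ((P v)%:R / (Q v)%:R : rat) \in I).
Proof.
move=> rP rQ; case: I => l u.
apply: eq_recursive (@recursive_and _
  (fun v => (l <= BLeft ((P v)%:R / (Q v)%:R))%O)
  (fun v => (BRight ((P v)%:R / (Q v)%:R) <= u)%O) _ _) => [v||].
- by rewrite inE.
- case: l => [[] c|b].
  + exact: recursive_le_frac.
  + apply: eq_recursive (recursive_not (recursive_ge_frac c rP rQ)) => v.
    by rewrite -ltNge.
  + by apply: eq_recursive (recursive_const n b) => v; case: b.
- case: u => [[] c|b].
  + apply: eq_recursive (recursive_not (recursive_le_frac c rP rQ)) => v.
    by rewrite -ltNge.
  + exact: recursive_ge_frac.
  + by apply: eq_recursive (recursive_const n (~~ b)) => v; case: b.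
Qed.

(** * Denominators, and simulation of the map on numerators *)

Lemma denq_dvdP (q : rat) (m : nat) :
  (q * m%:R \is a Num.int) = (`|denq q| %| m)%N.
Proof.
have d0 : (denq q)%:~R != 0 :> rat by rewrite intr_eq0 denq_neq0.
have cop : coprimez (denq q) (numq q).
  by rewrite coprimez_sym /coprimez /gcdz (eqP (coprime_num_den q)).
rewrite -[(_ %| _)%N]/(denq q %| m%:Z)%Z -(Gauss_dvdzr _ cop).
apply/idP/idP => [/intrP[k qm]|/dvdzP[k qm]].
  apply/dvdzP; exists k; apply: (@intr_inj rat).
  by rewrite !rmorphM /= -qm numqE -pmulrn mulrAC.
apply/intrP; exists k; apply: (mulIf d0).
by rewrite -rmorphM -qm rmorphM /= numqE -pmulrn mulrAC.
Qed.

Lemma common_denominator (I : finType) (r : I -> rat) :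
  exists (E : nat) (A : I -> int),
    (0 < E)%N /\ forall i, r i = (A i)%:~R / E%:R.
Proof.
pose E := (\prod_i `|denq (r i)|)%N.
have E0 : (0 < E)%N by apply: prodn_gt0 => i; rewrite absz_gt0 denq_neq0.
exists E, (fun i => numq (r i * E%:R)); split => // i.
rewrite numqK ?mulfK ?pnatr_eq0 -?lt0n //.
by rewrite denq_dvdP /E (bigD1 i) //= dvdn_mulr.
Qed.

Lemma eq_S1_mod1 (x y : rat) : 0 <= x < 1 -> 0 <= y < 1 ->
  x - y \is a Num.int -> x = y.
Proof.
move=> hx hy /intrP[k xy].
suff k0 : k = 0 by apply/eqP; rewrite -subr_eq0 xy k0.
have : (-1)%:~R < k%:~R :> rat /\ k%:~R < 1%:~R :> rat.
  by rewrite mulrN1z mulr1z -xy; split; lra.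
by rewrite !ltr_int; lia.
Qed.

Lemma S1_numdenE (x : S1) :
  \val x = `|numq (\val x)|%N%:R / `|denq (\val x)|%N%:R.
Proof.
rewrite -{1}[\val x]divq_num_den !pmulrn !gez0_abs ?denq_ge0 // numq_ge0.
by case/andP: (valP x).
Qed.

(* If slope f i = A i / E and offset f i = B i / E for all i, this is the
   numerator of f (p / q) over the denominator E * q.  As fractions are never
   reduced, the k-th iterate has the explicit denominator E ^ k * q, and an
   algorithm iterating f only has to store a numerator. *)
Definition pam_num l (f : PAM l) (E : nat) (A B : 'I_l -> int) (p q : nat) :=
  (\sum_(i < l) ((p%:R / q%:R : rat) \in pam_itv f i) *
     absz ((A i * p%:Z + B i * q%:Z) %% (E * q)%N%:Z)%Z)%N.

Lemma recursive_pam_num l (f : PAM l) E A B n (P Q : n.-tuple nat -> nat) :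
  recursive P -> recursive Q ->
  recursive (fun v => pam_num f E A B (P v) (Q v)).
Proof.
move=> rP rQ; apply: recursive_sum => i; apply: recursive_mul.
  exact: recursive_itv.
apply: recursive_lin_modz => //.
by apply: recursive_mul => //; exact: recursive_const.
Qed.

(** Only the term of the interval containing [x] survives in the sum. Reducing a numerator modulo
    [E * q] reduces the fraction modulo 1, so both sides represent the same class in [0,1[. *)
Lemma pam_numE l (f : PAM l) E A B (x : S1) (p q : nat) :
  (0 < E)%N -> (0 < q)%N ->
  (forall i, slope f i = (A i)%:~R / E%:R) ->
  (forall i, offset f i = (B i)%:~R / E%:R) ->
  \val x = p%:R / q%:R ->
  \val (f x) = (pam_num f E A B p q)%:R / (E * q)%:R.
Proof.
move=> E0 q0 sE oE xE; have [i xi] := pam_itv_cover f x.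
have -> : pam_num f E A B p q =
    absz ((A i * p%:Z + B i * q%:Z) %% (E * q)%N%:Z)%Z.
  rewrite /pam_num (bigD1 i) //= -xE xi mul1n big1 ?addn0 // => j ji.
  case: (boolP (_ \in _)) => // xj.
  by rewrite (pam_itv_disj xi xj) eqxx in ji.
set X := _ + _; set m := (E * q)%N.
have m0 : (0 < m)%N by rewrite muln_gt0 E0.
have mZ : m%:Z != 0 by lia.
rewrite !pmulrn gez0_abs ?modz_ge0 //.
have m0r : 0 < m%:~R :> rat by rewrite -pmulrn ltr0n.
apply: eq_S1_mod1; first exact: (valP (f x)).
  rewrite divr_ge0 ?ler0z ?modz_ge0 ?ltW // ltr_pdivrMr // mul1r ltr_int.
  exact: ltz_pmod.
have /intrP[k fk] := @pam_mapE _ f i x xi.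
apply/intrP; exists ((X %/ m)%Z - k).
rewrite intrB -fk {}xE sE oE.
have -> : (X %% m)%Z = X - (X %/ m)%Z * m by rewrite {2}(divz_eq X m); ring.
have mE : m%:~R = E%:R * q%:R :> rat by rewrite -pmulrn natrM.
rewrite intrB intrM mE intrD !intrM -!pmulrn.
by field; rewrite !pnatr_eq0 -!lt0n E0 q0.
Qed.

(** The bound is computable from the codes of [x] and [y], so it suffices to simulate that many
    iterates and compare each with [y]. *)
Lemma decidable_of_orbit_bound l (f : PAM l) (C : nat) :
  (forall x y n, iter n f x = y -> exists2 i,
     (i < C * `|denq (\val x)| * `|denq (\val y)|)%N & iter i f x = y) ->
  reachability_decidable f.
Proof.
move=> bound.
have [E [AB [E0 ABE]]] := common_denominator
  (fun s : 'I_l + 'I_l =>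
     match s with inl i => slope f i | inr i => offset f i end).
pose A i := AB (inl i); pose B i := AB (inr i).
(* Numerator of the [k]-th iterate of p / q over the denominator [E ^ k * q]. *)
pose N k p q : nat :=
  nat_rect (fun=> nat) p (fun k z => pam_num f E A B z (E ^ k * q)) k.
have NE k (x : S1) p q : (0 < q)%N -> \val x = p%:R / q%:R ->
    \val (iter k f x) = (N k p q)%:R / (E ^ k * q)%:R.
  move=> q0 xE; elim: k => [|k IHk] /=; first by rewrite mul1n.
  rewrite expnS -mulnA; apply: pam_numE IHk => //.
  - by rewrite muln_gt0 expn_gt0 E0.
  - by move=> i; rewrite (ABE (inl i)).
  - by move=> i; rewrite (ABE (inr i)).
(* Equality of the [k]-th iterate with the second point, by cross-multiplication. *)
pose test k (v : 4.-tuple nat) :=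
  (N k (tnth v 0%R) (tnth v 1%R) * tnth v 3%R ==
   tnth v 2%R * (E ^ k * tnth v 1%R))%N.
have rB : recursive (fun v : 4.-tuple nat => C * tnth v 1%R * tnth v 3%R)%N.
  apply: recursive_mul (recursive_proj _).
  exact: recursive_mul (recursive_const _ _) (recursive_proj _).
have rtest : recursive (fun w : 6.-tuple nat => test (tnth w ord0) (tail2 w)).
  have rk : recursive (fun w : 6.-tuple nat => tnth w ord0) := recursive_proj _.
  have rt i : recursive (fun w : 6.-tuple nat => tnth (tail2 w) i).
    exact: recursive_tail2 (recursive_proj i).
  have rE m (F : m.-tuple nat -> nat) :
      recursive F -> recursive (fun v => E ^ F v)%N.
    exact: recursive_exp (recursive_const _ _).
  apply: recursive_eq; last first.
    by apply: recursive_mul => //; apply: recursive_mul => //; exact: rE.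
  apply: recursive_mul => //.
  apply: (@recursive_rect _ (fun w => tnth w ord0) _
    (fun k z w => pam_num f E A B z (E ^ k * tnth (tail2 w) 1%R)%N)) => //.
  apply: recursive_pam_num; first exact: recursive_proj.
  apply: recursive_mul; last exact: (recursive_tail2 (rt 1)).
  exact: rE (recursive_proj _).
have [e eE] := recursive_has_iota rB rtest.
exists e => -[x y] /=.
have d0 (z : S1) : (0 < `|denq (\val z)|)%N by rewrite absz_gt0 denq_neq0.
have testE k : test k (code_points (x, y)) = (iter k f x == y).
  rewrite /test !(tnth_nth 0%N) /= -val_eqE /=.
  rewrite (NE k x _ _ (d0 x) (S1_numdenE x)) [X in _ = (_ == X)]S1_numdenE.
  rewrite eqr_div ?pnatr_eq0 -?lt0n ?muln_gt0 ?expn_gt0 ?E0 ?d0 //.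
  by rewrite -!natrM eqr_nat.
have := eE (code_points (x, y)); set b := has _ _.
have bE : b <-> orbit_of f x y.
  split=> [/hasP[k _]|[n _ /bound[k kC xy]]].
    by rewrite testE => /eqP; exists k.
  by apply/hasP; exists k; rewrite ?testE ?xy // mem_iota add0n !(tnth_nth 0%N).
case: b bE => -[bE Eb]; split=> // oxy.
- by case: (oxy (bE _)).
- by have := Eb oxy.
Qed.

(** * Rational numbers integral at a prime *)

(* q belongs to the localization of the integers at p. *)
Definition pint (p : nat) (q : rat) :=
  exists2 d : nat, coprime p d & q * d%:R \is a Num.int.

Lemma pint_int p q : q \is a Num.int -> pint p q.
Proof. by exists 1%N; rewrite ?coprimen1 ?mulr1. Qed.

Lemma pintM p q r : pint p q -> pint p r -> pint p (q * r).
Proof.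
move=> [d pd qd] [e pe re]; exists (d * e)%N; first by rewrite coprimeMr pd.
by rewrite natrM mulrACA rpredM.
Qed.

Lemma pintD p q r : pint p q -> pint p r -> pint p (q + r).
Proof.
move=> [d pd qd] [e pe re]; exists (d * e)%N; first by rewrite coprimeMr pd.
rewrite natrM mulrDl mulrA [d%:R * _]mulrC mulrA.
by rewrite rpredD // rpredM // ?natr_int ?rpred_nat.
Qed.

Lemma pintB p q r : pint p q -> pint p r -> pint p (q - r).
Proof.
move=> pq [d pd rd]; apply: pintD => //; exists d => //.
by rewrite mulNr rpredN.
Qed.

Lemma pintX p q n : pint p q -> pint p (q ^+ n).
Proof.
move=> pq; elim: n => [|n IHn].
  by rewrite expr0; apply: pint_int; exact: rpred1.
by rewrite exprS; exact: pintM.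
Qed.

(** The factor [p ^ m] must absorb the whole [p]-part of the denominator; the part prime to [p] is
    left to the witness of [pint]. *)
Lemma pint_expP p m q : prime p ->
  pint p ((p ^ m)%:R * q) <-> (logn p `|denq q| <= m)%N.
Proof.
move=> pp; split=> [[d pd]|le].
  have d0 : (0 < d)%N.
    by case: d pd => //; rewrite /coprime gcdn0; case: p pp => [|[]].
  rewrite mulrAC [_ * q]mulrC -natrM denq_dvdP => /(dvdn_leq_log p).
  rewrite muln_gt0 d0 expn_gt0 prime_gt0 // => /(_ isT).
  have pm0 : (0 < p ^ m)%N by rewrite expn_gt0 prime_gt0.
  by rewrite lognM // (pfactorK m pp) (logn_coprime pd) addn0.
have [|d pd dE] := pfactor_coprime pp (_ : 0 < `|denq q|)%N.
  by rewrite absz_gt0 denq_neq0.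
exists d => //; rewrite mulrAC [_ * q]mulrC -natrM denq_dvdP.
by rewrite [X in (X %| _)%N]dE mulnC dvdn_mul // dvdn_exp2l.
Qed.

(** Here [u] is the [p]-adic valuation of [q] and [r] a unit of the localization at [p]. The last
    clause serves the case where the logarithms of both slopes vanish. *)
Lemma padic_split p q : prime p -> q != 0 ->
  exists (u : int) (r : rat),
    [/\ q = p%:R ^ u * r, pint p r, pint p r^-1 & (`|q| = 1 -> u = 0)].
Proof.
move=> pp q0; have [q1|q1] := eqVneq `|q| 1.
  have qI : q \is a Num.int.
    case: (ger0P q) q1 => _ q1; first by rewrite q1 rpred1.
    by rewrite -[q]opprK q1 rpredN rpred1.
  have qV : q^-1 = q.
    apply: (mulfI q0); rewrite divff // -expr2.
    by rewrite -(real_normK (num_real q)) q1 expr1n.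
  by exists 0, q; rewrite expr0z mul1r qV; split=> //; exact: pint_int.
have p0 : p%:R != 0 :> rat by rewrite pnatr_eq0 -lt0n prime_gt0.
have [|n pn nE] := pfactor_coprime pp (_ : 0 < `|numq q|)%N.
  by rewrite absz_gt0 numq_eq0.
have [|d pd dE] := pfactor_coprime pp (_ : 0 < `|denq q|)%N.
  by rewrite absz_gt0 denq_neq0.
have nz m : coprime p m -> m%:R != 0 :> rat.
  move=> pm; rewrite pnatr_eq0; apply: contraTneq pm => ->.
  by rewrite /coprime gcdn0; case: p pp {p0 pn nE pd dE} => [|[]].
have [n0 d0] := (nz n pn, nz d pd).
set e := logn p `|numq q| in nE; set g := logn p `|denq q| in dE.
exists (e%:Z - g%:Z), (Num.sg q * n%:R / d%:R).
have sI : Num.sg q \is a Num.int.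
  by case: sgrP q0 => //; rewrite ?rpred1 // rpredN rpred1.
split=> [|||/eqP]; last by rewrite (negPf q1).
- rewrite {1}[q]numEsg -{2}[q]divq_num_den normrM normfV.
  rewrite -!intr_norm -!natr_absz nE dE.
  rewrite expfzDr // -exprnN -exprnP !natrM !natrX.
  by field; rewrite d0 expf_neq0.
- by exists d => //; rewrite mulfVK // rpredM ?rpred_nat.
- exists n => //; rewrite !invfM invrK mulrAC mulfVK // rpredM ?rpred_nat //.
  rewrite [(Num.sg q)^-1](_ : _ = Num.sg q) //.
  by case: sgrP q0 => //; rewrite ?invr1 // invrN invr1.
Qed.

(** * Products of slopes with bounded logarithm *)

(** With c = u - A w / B one has m u + n w = m c + (w / B) (m A + n B). The last term is bounded,
    and m c keeps the sign of c for all natural m, so this sign selects the side. *)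
Lemma sum_bounded_one_sided (R : realType) (A B L : R) (u w : int) :
  (A = 0 -> B = 0 -> u = 0 /\ w = 0) ->
  exists K : nat,
    (forall m n : nat, `|m%:R * A + n%:R * B| <= L ->
       - K%:Z <= m%:Z * u + n%:Z * w)
    \/ (forall m n : nat, `|m%:R * A + n%:R * B| <= L ->
       m%:Z * u + n%:Z * w <= K%:Z).
Proof.
wlog B0 : A B u w / B != 0 => [IH|_].
  (* If B = 0, exchange the two pairs; if A vanishes as well, then u = w = 0. *)
  have [B0|B0] := eqVneq B 0; last exact: IH B0.
  have [A0|A0 _] := eqVneq A 0.
    by move=> /(_ A0 B0)[-> ->]; exists 0%N; left=> m n _; rewrite !mulr0.
  have [|K HK] := IH B A w u A0; first by move=> _ /eqP; rewrite (negPf A0).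
  exists K; case: HK => HK; [left|right] => m n;
    rewrite [_ + n%:R * B]addrC [m%:Z * u + _]addrC; exact: HK.
pose c := u%:~R - A * w%:~R / B; pose T := `|w%:~R / B| * L.
(* The sign of [L] is not known, and the Archimedean bound is for nonnegative numbers, hence the
   norm. *)
exists (Num.bound `|T|).
have bT : T <= (Num.bound `|T|)%:R.
  by apply: le_trans (ler_norm _) (ltW (archi_boundP _)).
have key m n : `|m%:R * A + n%:R * B| <= L ->
    `|(m%:Z * u + n%:Z * w)%:~R - m%:R * c| <= (Num.bound `|T|)%:R.
  move=> le; apply: le_trans bT.
  have -> : (m%:Z * u + n%:Z * w)%:~R - m%:R * c
      = (w%:~R / B) * (m%:R * A + n%:R * B).
    by rewrite intrD !intrM -!pmulrn /c; field.
  by rewrite normrM ler_wpM2l.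
have [c0|c0] := leP 0 c; [left|right] => m n /key;
  rewrite ler_norml => /andP[le1 le2]; rewrite -(ler_int R) ?rmorphN /= -pmulrn.
- by have := mulr_ge0 (ler0n R m) c0; lra.
- by have := mulr_ge0_le0 (ler0n R m) (ltW c0); lra.
Qed.

(** The monomial is a power of [p] times a unit at [p], and its exponent of [p] is bounded on one
    side. Both [K] and the side are chosen before [m] and [n]. *)
Lemma bounded_monomial_pint (R : realType) (a b : rat) (L : R) (p : nat) :
  prime p -> a != 0 -> b != 0 -> exists K : nat,
    (forall m n, `|ln `|ratr (a ^+ m * b ^+ n) : R| | <= L ->
       pint p ((p ^ K)%:R * (a ^+ m * b ^+ n)))
    \/ (forall m n, `|ln `|ratr (a ^+ m * b ^+ n) : R| | <= L ->
       pint p ((p ^ K)%:R * (a ^+ m * b ^+ n)^-1)).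
Proof.
move=> pp a0 b0.
have [u [r [aE pr prV ua]]] := padic_split pp a0.
have [w [s [bE ps psV wb]]] := padic_split pp b0.
have p0 : p%:R != 0 :> rat by rewrite pnatr_eq0 -lt0n prime_gt0.
have ln1_eq (q : rat) : q != 0 -> ln `|ratr q : R| = 0 -> `|q| = 1.
  move=> q0 lq; have q0' : 0 < `|ratr q : R| by rewrite normr_gt0 fmorph_eq0.
  have : `|ratr q : R| = 1 by rewrite -(lnK q0') lq expR0.
  by rewrite -ratr_norm -[1 in RHS](rmorph1 (ratr : rat -> R)) => /fmorph_inj.
have [|K HK] := @sum_bounded_one_sided R (ln `|ratr a|) (ln `|ratr b|) L u w.
  by move=> la lb; rewrite ua ?wb //; apply: ln1_eq.
have lnE m n : ln `|ratr (a ^+ m * b ^+ n) : R|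
    = m%:R * ln `|ratr a| + n%:R * ln `|ratr b|.
  have gt0 (q : rat) : q != 0 -> `|ratr q : R| \is Num.pos.
    by rewrite posrE normr_gt0 fmorph_eq0.
  rewrite rmorphM !rmorphXn normrM !normrX lnM ?rpredX ?gt0 //.
  by rewrite !lnXn -?posrE ?gt0 // !mulr_natl.
have abE m n : a ^+ m * b ^+ n
    = p%:R ^ (m%:Z * u + n%:Z * w) * (r ^+ m * s ^+ n).
  rewrite {1}aE {1}bE !exprMn mulrACA expfzDr // ; congr (_ * _ * _).
    by rewrite mulrC -exprz_exp.
  by rewrite mulrC -exprz_exp.
have pow (z : int) : - K%:Z <= z -> (p ^ K)%:R * p%:R ^ z \is a (@Num.int rat).
  move=> Kz; rewrite natrX -[_ ^+ K]/(p%:R ^ K%:Z) -expfzDr //.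
  have : 0 <= K%:Z + z by lia.
  by case: (K%:Z + z) => // e _; rewrite -exprnP -natrX rpred_nat.
exists K; case: HK => HK; [left|right] => m n;
  rewrite lnE => /HK Kz; rewrite abE.
- rewrite mulrA; apply: pintM; first exact/pint_int/pow.
  by apply: pintM; exact: pintX.
- rewrite invfM invr_expz mulrA; apply: pintM; first by apply/pint_int/pow; lia.
  by rewrite invfM -!exprVn; apply: pintM; exact: pintX.
Qed.

(** * Derivatives and denominators along an orbit *)

(** By the chain rule, the derivative of the [n]-th iterate at [x]. *)
Definition orbit_deriv l (f : PAM l) (x : S1) (n : nat) : rat :=
  \prod_(j < n) pam_deriv f (iter j f x).

Lemma pam_derivE l (f : PAM l) i (x : S1) :
  \val x \in pam_itv f i -> pam_deriv f x = slope f i.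
Proof.
move=> xi; rewrite /pam_deriv (bigD1 i) //= big1 ?addr0 // => j /andP[xj].
by rewrite (pam_itv_disj xj xi) eqxx.
Qed.

Lemma pam_mapD l (f : PAM l) (x : S1) : exists i (m : int),
  \val (f x) = pam_deriv f x * \val x + (offset f i - m%:~R).
Proof.
have [i xi] := pam_itv_cover f x.
have /intrP[m fm] := @pam_mapE _ f i x xi.
by exists i, m; rewrite -fm (pam_derivE xi); ring.
Qed.

Lemma orbit_derivS l (f : PAM l) x n :
  orbit_deriv f x n.+1 = pam_deriv f x * orbit_deriv f (f x) n.
Proof.
rewrite /orbit_deriv big_ord_recl; congr (_ * _).
by apply: eq_bigr => j _; rewrite -iterSr.
Qed.

Lemma orbit_derivSr l (f : PAM l) x n :
  orbit_deriv f x n.+1 = orbit_deriv f x n * pam_deriv f (iter n f x).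
Proof. exact: big_ord_recr. Qed.

(** The exponents count the visits of the segment to the two intervals. *)
Lemma orbit_deriv_monomial (f : PAM 2) x n : exists k m,
  orbit_deriv f x n = slope f ord0 ^+ k * slope f ord_max ^+ m.
Proof.
elim: n => [|n [k [m IHn]]].
  by exists 0%N, 0%N; rewrite /orbit_deriv big_ord0 mulr1.
have [i xi] := pam_itv_cover f (iter n f x).
rewrite orbit_derivSr IHn (pam_derivE xi).
have [->|->] : i = ord0 \/ i = ord_max.
  by case: i {xi} => -[|[|//]] ?; [left|right]; exact: val_inj.
- by exists k.+1, m; rewrite exprS; ring.
- by exists k, m.+1; rewrite exprS; ring.
Qed.

Lemma pint_offset p k l (f : PAM l) i (m : int) :
  (forall i, pint p ((p ^ k)%:R * offset f i)) ->
  pint p ((p ^ k)%:R * (offset f i - m%:~R)).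
Proof.
move=> po; rewrite mulrBr; apply: pintB => //.
by apply: pint_int; rewrite rpredM ?rpred_nat ?intr_int.
Qed.

(** The [n]-th iterate is affine in [x]: its linear coefficient is a product of slopes, and its
    constant [w] is a sum of offsets, up to integers, times products of slopes over final segments.
    Integrality at [p] is stable under sums, so the bound does not grow with [n]. *)
Lemma logn_denq_iter p K k l (f : PAM l) : prime p ->
  (forall x n, pint p ((p ^ K)%:R * orbit_deriv f x n)) ->
  (forall i, pint p ((p ^ k)%:R * offset f i)) ->
  forall x n, (logn p `|denq (\val (iter n f x))| <=
               K + k + logn p `|denq (\val x)|)%N.
Proof.
move=> pp pK po x n; apply/(pint_expP _ _ pp).
have [w wE pw] : exists2 w,
    \val (iter n f x) = orbit_deriv f x n * \val x + w
    & pint p ((p ^ (K + k))%:R * w).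
  elim: n x => [|n IHn] x.
    exists 0; rewrite /orbit_deriv ?big_ord0 ?mul1r ?addr0 // mulr0.
    exact: pint_int.
  (* Peeling off the first step leaves its offset multiplied by the derivative along the remaining
     segment, which starts at [f x]. *)
  have [i [m fx]] := pam_mapD f x; have [w wE pw] := IHn (f x).
  exists (orbit_deriv f (f x) n * (offset f i - m%:~R) + w).
    by rewrite iterSr wE fx orbit_derivS; ring.
  rewrite mulrDr; apply: pintD => //; rewrite expnD natrM mulrACA.
  by apply: pintM => //; exact: pint_offset.
rewrite wE mulrDr; apply: pintD.
  rewrite expnD natrM mulrACA expnD natrM -[_%:R * _%:R * _]mulrAC.
  apply: pintM; last by apply/(pint_expP _ _ pp).
  by apply: pintM => //; apply: pint_int; exact: rpred_nat.
rewrite expnD mulnC natrM -mulrA; apply: pintM => //.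
by apply: pint_int; exact: rpred_nat.
Qed.

(** Solving the affine relation for [x] puts inverse products of slopes in front of the end point
    and of the offsets. *)
Lemma logn_denq_iter_inv p K k l (f : PAM l) : prime p ->
  (forall x, pam_deriv f x != 0) ->
  (forall x n, pint p ((p ^ K)%:R * (orbit_deriv f x n)^-1)) ->
  (forall i, pint p ((p ^ k)%:R * offset f i)) ->
  forall x n, (logn p `|denq (\val x)| <=
               K + k + logn p `|denq (\val (iter n f x))|)%N.
Proof.
move=> pp f0 pK po x n; apply/(pint_expP _ _ pp).
have [w wE pw] : exists2 w,
    \val x = (orbit_deriv f x n)^-1 * \val (iter n f x) - w
    & pint p ((p ^ (K + k))%:R * w).
  elim: n => [|n [w wE pw]].
    exists 0; rewrite /orbit_deriv ?big_ord0 ?invr1 ?mul1r ?subr0 // mulr0.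
    exact: pint_int.
  (* Here the last step is peeled off, so that every inverse product starts at [x]. *)
  have [i [m fx]] := pam_mapD f (iter n f x).
  exists ((orbit_deriv f x n.+1)^-1 * (offset f i - m%:~R) + w).
    rewrite iterS fx orbit_derivSr {1}wE; field.
    by rewrite f0 /orbit_deriv; apply/prodf_neq0 => j _; exact: f0.
  rewrite mulrDr; apply: pintD => //; rewrite expnD natrM mulrACA.
  by apply: pintM => //; exact: pint_offset.
rewrite wE mulrBr; apply: pintB.
  rewrite expnD natrM mulrACA expnD natrM -[_%:R * _%:R * _]mulrAC.
  apply: pintM; last by apply/(pint_expP _ _ pp).
  by apply: pintM => //; apply: pint_int; exact: rpred_nat.
rewrite expnD mulnC natrM -mulrA; apply: pintM => //.
by apply: pint_int; exact: rpred_nat.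
Qed.

Lemma dvdn_logn (m n : nat) : (0 < m)%N -> (0 < n)%N ->
  (forall p, prime p -> (logn p m <= logn p n)%N) -> (m %| n)%N.
Proof.
move=> m0 n0 mn; apply/dvdn_partP => // p; rewrite mem_primes => /and3P[pp _ _].
by rewrite p_part pfactor_dvdn // mn.
Qed.

Lemma prime_gt_logn0 (m p : nat) : (0 < m < p)%N -> logn p m = 0%N.
Proof.
case/andP=> m0 mp; apply/eqP; rewrite -leqn0 leqNgt logn_gt0 mem_primes m0 /=.
by apply/negP => /andP[_ /(dvdn_leq m0)]; rewrite leqNgt mp.
Qed.

(** [C] collects one power of each prime up to [N]; larger primes divide no denominator of a slope
    or offset and need no correction. *)
Lemma denq_orbit_dvd (R : realType) (L : R) (f : PAM 2) :
  (forall x, pam_deriv f x != 0) ->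
  (forall x n, `|ln `|ratr (orbit_deriv f x n) : R| | <= L) ->
  exists2 C : nat, (0 < C)%N & forall x m n, (m <= n)%N ->
    (`|denq (\val (iter m f x))| %|
       C * `|denq (\val x)| * `|denq (\val (iter n f x))|)%N.
Proof.
move=> f0 fL.
have slope0 i : slope f i != 0.
  have [x xi] := pam_itv_neq0 f i.
  by have := f0 (Sub x (pam_itv_sub xi)); rewrite (@pam_derivE _ _ i).
have d0 (q : rat) : (0 < `|denq q|)%N by rewrite absz_gt0 denq_neq0.
pose N := (\prod_(i < 2) (`|denq (slope f i)| * `|denq (offset f i)|))%N.
have N0 : (0 < N)%N by apply: prodn_gt0 => i; rewrite muln_gt0 !d0.
(* Adding the exponents at both ends covers the forward and the backward estimate at once. *)
pose good p K := forall x m n, (m <= n)%N ->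
  (logn p `|denq (\val (iter m f x))| <=
   K + (logn p `|denq (\val x)| + logn p `|denq (\val (iter n f x))|))%N.
have good_big p : prime p -> (N < p)%N -> good p 0%N.
  move=> pp Np x m n mn; rewrite add0n.
  have pi i : pint p ((p ^ 0)%:R * slope f i) /\
      pint p ((p ^ 0)%:R * offset f i).
    have le q : (`|denq q| %| N)%N -> logn p `|denq q| = 0%N.
      move=> qN; apply: prime_gt_logn0; rewrite d0 /=.
      by apply: leq_ltn_trans Np; exact: dvdn_leq.
    split; apply/(pint_expP _ _ pp); rewrite leqn0 le //.
      by rewrite /N (bigD1 i) //= -mulnA dvdn_mulr.
    by rewrite /N (bigD1 i) //= -mulnA mulnCA dvdn_mulr.
  apply: leq_trans (@logn_denq_iter p 0 0 _ f pp _ _ x m) _.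
  - move=> z k; rewrite mul1r /orbit_deriv.
    apply: big_ind; [exact: pint_int | exact: pintM | move=> j _].
    have [i zi] := pam_itv_cover f (iter j f z).
    by rewrite (pam_derivE zi); have [] := pi i; rewrite mul1r.
  - by move=> i; have [] := pi i.
  - by rewrite add0n leq_addr.
have good_ex p : exists K, prime p -> good p K /\ ((N < p)%N -> K = 0%N).
  have [pp|] := boolP (prime p); last by exists 0%N.
  have [Np|pN] := ltnP N p; first by exists 0%N; split=> //; exact: good_big.
  have [K HK] := bounded_monomial_pint L pp (slope0 ord0) (slope0 ord_max).
  pose k := (\max_(i < 2) logn p `|denq (offset f i)|)%N.
  have ko i : pint p ((p ^ k)%:R * offset f i).
    by apply/(pint_expP _ _ pp); exact: (leq_bigmax i).
  exists (K + k)%N => _; split=> // x m n mn; case: HK => HK.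
  - apply: leq_trans (logn_denq_iter pp _ ko x m) _ => [z j|].
      have [r [s E]] := orbit_deriv_monomial f z j.
      by rewrite E; apply: HK; rewrite -E.
    by rewrite leq_add2l leq_addr.
  (* Backward estimate on the segment of [n - m] steps from the [m]-th to the [n]-th iterate. *)
  - apply: leq_trans (logn_denq_iter_inv pp f0 _ ko _ (n - m)) _ => [z j|].
      have [r [s E]] := orbit_deriv_monomial f z j.
      by rewrite E; apply: HK; rewrite -E.
    by rewrite -iterD subnK // leq_add2l leq_addl.
have /choice[K HK] := good_ex.
pose C := (\prod_(p < N.+1 | prime p) p ^ K p)%N.
have C0 : (0 < C)%N.
  by apply: prodn_cond_gt0 => p pp; rewrite expn_gt0 prime_gt0.
exists C => // x m n mn; apply: dvdn_logn => // [|p pp].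
  by rewrite !muln_gt0 C0 !d0.
rewrite -mulnA !lognM ?muln_gt0 ?d0 //; have [gp Kp] := HK p pp.
apply: leq_trans (gp x m n mn) _; rewrite leq_add2r.
have [/Kp -> //|pN] := ltnP N p.
rewrite -pfactor_dvdn // /C (bigD1 (Ordinal (pN : (p < N.+1)%N))) //=.
exact: dvdn_mulr.
Qed.

(** * Repetition in orbits with a common denominator *)

(** Pigeonhole: [0,1[ contains only [D] multiples of 1 / D. If n >= D, the first [D.+1] points of
    the orbit are such multiples, hence not distinct, and the orbit stays among its first [D]
    points. *)
Lemma orbit_hits_before_denominator (f : S1 -> S1) (x : S1) (n D : nat) :
  (forall m, (m <= n)%N -> (`|denq (\val (iter m f x))| %| D)%N) ->
  (0 < D)%N -> exists2 i, (i < D)%N & iter i f x = iter n f x.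
Proof.
move=> dD D0; have [nD|Dn] := ltnP n D; first by exists n.
have [/loopingP/(_ n)/trajectP[i iD ->]|] := boolP (looping f x D).
  by exists i.
rewrite -looping_uniq => uT.
pose g (z : S1) := absz (numq (\val z * D%:R)).
have gE z : z \in traject f x D.+1 -> (g z)%:R = \val z * D%:R :> rat.
  case/trajectP=> i iD ->; rewrite /g natr_absz ger0_norm.
    by rewrite numqK // denq_dvdP dD // (leq_trans _ Dn).
  by rewrite numq_ge0 mulr_ge0 //; case/andP: (valP (iter i f x)).
have D0r : 0 < D%:R :> rat by rewrite ltr0n.
have gu : uniq (map g (traject f x D.+1)).
  rewrite map_inj_in_uniq // => y z yT zT /(congr1 (fun k => k%:R : rat)).
  rewrite !gE // => /(mulIf (lt0r_neq0 D0r)); exact: val_inj.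
have sub : {subset map g (traject f x D.+1) <= iota 0 D}.
  move=> k /mapP[z zT ->].
  rewrite mem_iota add0n /= -(ltr_nat rat) gE // -[ltRHS]mul1r ltr_pM2r //.
  by case/andP: (valP z).
by have := uniq_leq_size gu sub; rewrite size_map size_traject size_iota ltnn.
Qed.

(** * Invariant densities and decidability *)

(** By injectivity the fibre over [f x] is the single point [x], so the transfer sum has one
    term. *)
Lemma invariant_density_step (R : realType) l (f : PAM l) (phi : S1 -> R) :
  injective f -> transfer f phi = phi ->
  forall x, phi (f x) = phi x / `|ratr (pam_deriv f x)|.
Proof.
move=> fi phiE x; rewrite -[in LHS]phiE /transfer.
have -> : (f @^-1` [set f x] = [set x])%classic.
  by apply/seteqP; split=> y /= => [/fi|->].
by rewrite fsbig_set1.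
Qed.

Lemma invariant_density_iter (R : realType) l (f : PAM l) (phi : S1 -> R) :
  injective f -> transfer f phi = phi ->
  forall x n, phi (iter n f x) = phi x / `|ratr (orbit_deriv f x n)|.
Proof.
move=> fi phiE x; elim=> [|n IHn].
  by rewrite /orbit_deriv big_ord0 rmorph1 normr1 divr1.
rewrite iterS (invariant_density_step fi phiE) IHn orbit_derivSr rmorphM /=.
by rewrite [in RHS]normrM -mulrA -invfM.
Qed.

Theorem theorem1 (R : realType) (f : PAM 2) (hf : injective f)
    (hphi : exists (phi : S1 -> R) (Kmin Kmax : R),
      invariant_density f phi /\ 0 < Kmin /\
      (forall x : S1, Kmin < phi x < Kmax)) :
  reachability_decidable f.
Proof.
case: hphi => phi [Kmin [Kmax [[_ phiE] [Kmin0 phiK]]]].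
have phi0 x : 0 < phi x by case/andP: (phiK x) => /(lt_trans Kmin0).
(* A zero slope at [x] would give [phi (f x)] = 0, as division by 0 yields 0. *)
have f0 x : pam_deriv f x != 0.
  apply/negP => /eqP fx; have := phi0 (f x).
  rewrite (invariant_density_step hf phiE) fx rmorph0 normr0 invr0 mulr0.
  by rewrite ltxx.
have lnphi x : ln Kmin <= ln (phi x) <= ln Kmax.
  have /andP[lo hi] := phiK x.
  by rewrite !ler_ln ?posrE ?phi0 ?ltW // (lt_trans (phi0 x)).
have fL x n : `|ln `|ratr (orbit_deriv f x n) : R| | <= ln Kmax - ln Kmin.
  have P0 : 0 < `|ratr (orbit_deriv f x n) : R|.
    by rewrite normr_gt0 fmorph_eq0; apply/prodf_neq0 => j _; exact: f0.
  have := invariant_density_iter hf phiE x n.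
  (* The logarithm of the product is the difference of the values of [ln phi] at the two ends of the
     segment. *)
  move=> /(congr1 (@ln R)); rewrite ln_div ?posrE // => E.
  have /andP[? ?] := lnphi x; have /andP[? ?] := lnphi (iter n f x).
  by rewrite ler_norml; lra.
have [C C0 CP] := denq_orbit_dvd f0 fL.
apply: (@decidable_of_orbit_bound _ f C) => x y n xy.
(* This common denominator depends on [x] and [y] but not on [n], so it bounds the search. *)
have [||i iD ixy] := @orbit_hits_before_denominator f x n
    (C * `|denq (\val x)| * `|denq (\val y)|)%N.
- by move=> m mn; rewrite -xy; exact: CP.
- by rewrite !muln_gt0 C0 !absz_gt0 !denq_neq0.
- by exists i; rewrite ?ixy.
Qed.
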